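(* Let $d\ge 2$, let $V=\{v_1,\dots,v_{d+1}\}\subset\mathbb{R}^d$ be the set of vertices of a simplex $T=\mathrm{co}(V)$ with circumradius $r(V)$, and let $\rho>r(V)$. For $1\le i\le d+1$ let $B_i(\rho)$ be the unique open ball of radius $\rho$ such that $V\setminus\{v_i\}\subset\partial B_i(\rho)$ and $v_i\notin B_i(\rho)$. Then $$\mathrm{co}_\rho(V)=\mathrm{co}(V)\setminus\Big(\bigcup_{i=1}^{d+1}B_i(\rho)\Big).$$ Moreover $\rho\mapsto \mathrm{co}_\rho(V)$, $\rho>r(V)$, is a non-decreasing family of closed sets (with respect to inclusion), and $$\lim_{\rho\to+\infty}\mathrm{co}_\rho(V)=V\cup\mathrm{int}(T).$$
   Context: A body is a non-empty closed set. For a body $E\subset\mathbb{R}^d$ and $\rho>0$, the $\rho$-hulloid of $E$ is $\mathrm{co}_\rho(E)=\bigcap B^c$, the intersection over all open balls $B$ of radius $\rho$ with $B\cap E=\emptyset$ (with $\mathrm{co}_\rho(E)=\mathbb{R}^d$ if there are no such balls). $\mathrm{co}(V)$ is the convex hull of $V$. The circumradius $r(V)$ is the radius of the unique sphere in $\mathbb{R}^d$ containing $V$. For $\rho>r(V)$ the balls $B_i(\rho)$ exist and are unique. The limit of the monotone family of sets as $\rho\to+\infty$ is its union over all $\rho>r(V)$. *)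

(* Defs.v *)
From HB Require Import structures.
From mathcomp Require Import all_boot all_order all_algebra.
From mathcomp Require Import all_classical all_reals all_analysis.

Set Implicit Arguments.
Unset Strict Implicit.
Unset Printing Implicit Defensive.

Import Order.TTheory GRing.Theory Num.Theory.
Import numFieldNormedType.Exports.

Local Open Scope classical_set_scope.
Local Open Scope ring_scope.

(* The library norm and [ball] on ['rV[R]_d] are those of the sup norm, so the
   Euclidean ones are defined here.  The topology of ['rV[R]_d] (used by
   [closed], [closure] and [interior]) is the product topology, which is the
   Euclidean one. *)
Definition enorm (R : realType) (d : nat) (x : 'rV[R]_d) : R :=
  Num.sqrt (\sum_(k < d) x 0 k ^+ 2).

Definition eball (R : realType) (d : nat) (c : 'rV[R]_d) (r : R) :
    set 'rV[R]_d :=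
  [set x | enorm (x - c) < r].

Definition esphere (R : realType) (d : nat) (c : 'rV[R]_d) (r : R) :
    set 'rV[R]_d :=
  [set x | enorm (x - c) = r].

Definition boundary (T : topologicalType) (A : set T) : set T :=
  closure A `\` interior A.

Definition convex_hull (R : realType) (d : nat) (A : set 'rV[R]_d) :
    set 'rV[R]_d :=
  smallest (@convex_set R 'rV[R]_d) A.

(* [\bigcap] over an empty family of balls is [setT]. *)
Definition hulloid (R : realType) (d : nat) (rho : R) (E : set 'rV[R]_d) :
    set 'rV[R]_d :=
  \bigcap_(c in [set c | eball c rho `&` E = set0]) ~` eball c rho.

Definition affinely_independent (R : realType) (d n : nat)
    (v : 'I_n -> 'rV[R]_d) : Prop :=
  forall a : 'I_n -> R,
    \sum_(i < n) a i = 0 -> \sum_(i < n) a i *: v i = 0 -> forall i, a i = 0.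

(* A definite description: when [V] is the vertex set of a simplex of
   dimension [d], exactly one [r] satisfies the predicate. *)
Definition circumradius (R : realType) (d : nat) (V : set 'rV[R]_d) : R :=
  xget 0 [set r | 0 <= r /\ exists c, V `<=` esphere c r].

Definition is_opposite_ball (R : realType) (d : nat) (V : set 'rV[R]_d)
    (w : 'rV[R]_d) (rho : R) (B : set 'rV[R]_d) : Prop :=
  [/\ exists c, B = eball c rho, V `\ w `<=` boundary B & ~ B w].

(* Main.v *)
(** Write [pow c rho x = |x - c|^2 - rho^2] and let [o], [r] be the circumcenter
    and circumradius.  Two powers differ by an affine function, so in barycentric
    coordinates [pow c rho x = pow o r x + \sum_i beta_i lam_i(x)] with
    [beta_i = pow c rho (v i)].  A ball of radius [rho] misses [V] iff all
    [beta_i >= 0], and [B_i] is the one with [beta = b_i e_i], where [b_i > 0]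
    solves [|grad lam_i|^2 / 4 * b^2 - lam_i(o) b = rho^2 - r^2].  The [beta]
    attained by balls of radius [rho] lie on the level set of a convex quadratic
    that vanishes at [0], hence [\sum_i beta_i / b_i >= 1] when [beta >= 0], so
    that every admissible ball excludes no more of the circumball than the [B_i]
    do; points outside the circumball are excluded by a ball beyond it.  Thus
    [co_rho(V)] is the set where [pow o r <= 0] and [pow o r + b_i lam_i >= 0] for
    all [i].  Each [b_i] increases to infinity with [rho], which gives monotonicity
    and the limit, since the closed simplex meets the circumsphere only in [V]. *)
Require Import Defs.
From HB Require Import structures.
From mathcomp Require Import all_boot all_order all_algebra.
From mathcomp Require Import all_classical all_reals all_analysis.
From mathcomp Require Import ring lra.

Set Implicit Arguments.
Unset Strict Implicit.
Unset Printing Implicit Defensive.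

Import Order.TTheory GRing.Theory Num.Theory.
Import numFieldNormedType.Exports.

Local Open Scope classical_set_scope.
Local Open Scope ring_scope.

(** * Euclidean inner product *)

Definition dot (R : realType) (d : nat) (x y : 'rV[R]_d) : R :=
  \sum_(k < d) x 0 k * y 0 k.

Lemma dotC (R : realType) (d : nat) (x y : 'rV[R]_d) : dot x y = dot y x.
Proof. by apply: eq_bigr => k _; rewrite mulrC. Qed.

Lemma dotDl (R : realType) (d : nat) (x y z : 'rV[R]_d) :
  dot (x + y) z = dot x z + dot y z.
Proof. by rewrite -big_split; apply: eq_bigr => k _; rewrite mxE mulrDl. Qed.

Lemma dotZl (R : realType) (d : nat) (c : R) (x z : 'rV[R]_d) :
  dot (c *: x) z = c * dot x z.
Proof. by rewrite mulr_sumr; apply: eq_bigr => k _; rewrite mxE mulrA. Qed.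

Lemma dotNl (R : realType) (d : nat) (x z : 'rV[R]_d) :
  dot (- x) z = - dot x z.
Proof. by rewrite -scaleN1r dotZl mulN1r. Qed.

Lemma dotDr (R : realType) (d : nat) (x y z : 'rV[R]_d) :
  dot z (x + y) = dot z x + dot z y.
Proof. by rewrite dotC dotDl !(dotC z). Qed.

Lemma dotZr (R : realType) (d : nat) (c : R) (x z : 'rV[R]_d) :
  dot z (c *: x) = c * dot z x.
Proof. by rewrite dotC dotZl dotC. Qed.

Lemma dotNr (R : realType) (d : nat) (x z : 'rV[R]_d) :
  dot z (- x) = - dot z x.
Proof. by rewrite dotC dotNl dotC. Qed.

Definition dotE := (dotDl, dotDr, dotNl, dotNr, dotZl, dotZr).

Lemma dot0l (R : realType) (d : nat) (z : 'rV[R]_d) : dot 0 z = 0.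
Proof. by rewrite -(scale0r 0) dotZl mul0r. Qed.

Lemma dot_suml (R : realType) (d n : nat) (x : 'I_n -> 'rV[R]_d) (z : 'rV[R]_d) :
  dot (\sum_i x i) z = \sum_i dot (x i) z.
Proof. by apply: (big_morph (fun y => dot y z)) => [y y'|]; rewrite ?dotDl ?dot0l. Qed.

Lemma dot_ge0 (R : realType) (d : nat) (x : 'rV[R]_d) : 0 <= dot x x.
Proof. by apply: sumr_ge0 => k _; rewrite -expr2 sqr_ge0. Qed.

Lemma dot_eq0 (R : realType) (d : nat) (x : 'rV[R]_d) : dot x x = 0 -> x = 0.
Proof.
move=> /psumr_eq0P x0; apply/rowP => k; rewrite mxE.
have /eqP : x 0 k * x 0 k = 0 by apply: x0 => // j _; rewrite -expr2 sqr_ge0.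
by rewrite mulf_eq0 orbb => /eqP.
Qed.

Lemma dot_gt0 (R : realType) (d : nat) (x : 'rV[R]_d) : x != 0 -> 0 < dot x x.
Proof.
move=> x0; rewrite lt_neqAle dot_ge0 andbT eq_sym.
by apply: contra x0 => /eqP/dot_eq0 ->.
Qed.

Lemma dot_inj (R : realType) (d : nat) (x y : 'rV[R]_d) :
  (forall z, dot x z = dot y z) -> x = y.
Proof.
move=> xy; apply/eqP; rewrite -subr_eq0; apply/eqP/dot_eq0.
by rewrite dotDl dotNl xy subrr.
Qed.

Lemma cauchy_schwarz (R : realType) (d : nat) (x y : 'rV[R]_d) :
  dot x y ^+ 2 <= dot x x * dot y y.
Proof.
have [->|x0] := eqVneq x 0; first by rewrite !dot0l mul0r expr0n.
have xx := dot_gt0 x0.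
have := dot_ge0 (dot x x *: y - dot x y *: x).
rewrite !dotE (dotC y x) => h.
rewrite -subr_ge0 -(pmulr_rge0 _ xx).
by move: h; congr (0 <= _); ring.
Qed.

(** * Euclidean norm, open balls and their boundary *)

Lemma enormE (R : realType) (d : nat) (x : 'rV[R]_d) :
  enorm x = Num.sqrt (dot x x).
Proof. by rewrite /enorm; congr Num.sqrt; apply: eq_bigr => k _; rewrite expr2. Qed.

Lemma enorm_lt (R : realType) (d : nat) (x : 'rV[R]_d) (rho : R) :
  0 <= rho -> (enorm x < rho) = (dot x x < rho ^+ 2).
Proof.
move=> r0; rewrite enormE -[in RHS](sqr_sqrtr (dot_ge0 x)).
by rewrite ltr_pXn2r // nnegrE sqrtr_ge0.
Qed.

Lemma enorm_eq (R : realType) (d : nat) (x : 'rV[R]_d) (rho : R) :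
  0 <= rho -> enorm x = rho <-> dot x x = rho ^+ 2.
Proof.
move=> r0; rewrite enormE; split=> [<-|->]; first by rewrite sqr_sqrtr ?dot_ge0.
by rewrite sqrtr_sqr ger0_norm.
Qed.

Lemma eballP (R : realType) (d : nat) (c x : 'rV[R]_d) (rho : R) :
  0 <= rho -> ~ eball c rho x <-> rho ^+ 2 <= dot (x - c) (x - c).
Proof. by move=> r0; rewrite /eball /= enorm_lt // leNgt; split=> /negP. Qed.

Lemma continuous_dot (R : realType) (d : nat) (f g : 'rV[R]_d -> 'rV[R]_d) :
  continuous f -> continuous g -> continuous (fun x => dot (f x) (g x)).
Proof.
move=> cf cg x.
have coord (h : 'rV[R]_d -> 'rV[R]_d) k : continuous h ->
    (h y : 'rV[R]_d) 0 k @[y --> x] --> (h x : 'rV[R]_d) 0 k.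
  move=> ch; exact: (continuous_comp (ch x) (@coord_continuous _ _ _ 0 k (h x))).
apply: (@cvg_big _ _ _ _ _ _ _ (nbhs x)).
- exact: add_continuous.
- by move=> k _; apply: cvgM; exact: coord.
Qed.

Lemma continuous_sqdist (R : realType) (d : nat) (c : 'rV[R]_d) :
  continuous (fun x : 'rV[R]_d => dot (x - c) (x - c)).
Proof.
have cB : continuous (fun x : 'rV[R]_d => x - c).
  move=> x; apply: (@cvgB _ _ _ (nbhs x) _ id (cst c)); first exact: cvg_id.
  exact: cvg_cst.
exact: continuous_dot.
Qed.

Lemma open_eball (R : realType) (d : nat) (c : 'rV[R]_d) (rho : R) :
  0 <= rho -> open (eball c rho).
Proof.
move=> r0.
have -> : eball c rho = (fun x => dot (x - c) (x - c)) @^-1` [set y | y < rho ^+ 2].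
  by apply/seteqP; split=> x; rewrite /eball /= enorm_lt.
by apply: open_comp; [move=> x _; exact: continuous_sqdist|exact: open_lt].
Qed.

Lemma nbhs_segment (R : realType) (d : nat) (x y : 'rV[R]_d) (B : set 'rV[R]_d) :
  nbhs x B -> exists2 e : R, 0 < e & forall t, `|t| < e -> B (x + t *: y).
Proof.
move=> xB.
have cl : (x + t *: y) @[t --> (0 : R)] --> x.
  rewrite -[X in _ --> X]addr0 -[X in _ + X](scale0r y).
  by apply: cvgD; [exact: cvg_cst|apply: cvgZr_tmp; exact: cvg_id].
have /nbhs_ballP[e /= e0 He] := cl _ xB.
by exists e => // t te; apply: He; rewrite /ball /= sub0r normrN.
Qed.
Lemma boundary_eball (R : realType) (d : nat) (c : 'rV[R]_d) (rho : R) :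
  0 < rho -> boundary (eball c rho) = esphere c rho.
Proof.
move=> r0; have r0' := ltW r0.
apply/seteqP; split=> x; rewrite /boundary /esphere /=.
  move=> [clx]; rewrite ((interior_id _).1 (@open_eball _ _ c _ r0')).
  move=> /(eballP _ _ r0') ge; apply/enorm_eq => //.
  apply/eqP; rewrite eq_le ge andbT leNgt; apply/negP => gt.
  have : nbhs x ((fun x => dot (x - c) (x - c)) @^-1` [set y | rho ^+ 2 < y]).
    apply: open_nbhs_nbhs; split=> //; apply: open_comp; last exact: open_gt.
    by move=> y _; exact: continuous_sqdist.
  move=> /clx [y [/=]]; rewrite /eball /= enorm_lt // => h1 h2.
  by have := lt_trans h1 h2; rewrite ltxx.
move=> /(enorm_eq _ r0') e; split.
  move=> B /(nbhs_segment (c - x)) [k k0 hk].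
  (* The bound [k / 2] keeps the point in [B]; the bound [1 / 2] keeps [1 - t] positive, so that
     moving toward [c] scales the distance to [c] by [1 - t]. *)
  pose t := Num.min (k / 2) (1 / 2).
  have t0 : 0 < t by rewrite /t lt_min; apply/andP; split; lra.
  have tk : t < k by rewrite /t gt_min; apply/orP; left; lra.
  have t1 : t < 1 by rewrite /t gt_min; apply/orP; right; lra.
  exists (x + t *: (c - x)); split; last by apply: hk; rewrite gtr0_norm.
  rewrite /eball /= enorm_lt //.
  have -> : x + t *: (c - x) - c = (1 - t) *: (x - c).
    by rewrite -(opprB x c) scalerN scalerBl scale1r addrAC.
  rewrite dotZl dotZr e.
  have := exprn_gt0 2 r0; nra.
rewrite ((interior_id _).1 (@open_eball _ _ c _ r0')).
by apply/eballP => //; rewrite e.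
Qed.

(** * Convex combinations and barycentric coordinates by matrices *)

Lemma convex_set_comb (R : realType) (d : nat) (A : set 'rV[R]_d) :
  @convex_set R 'rV[R]_d A ->
  forall (n : nat) (a : 'I_n -> R) (x : 'I_n -> 'rV[R]_d),
  (forall i, 0 <= a i) -> (forall i, A (x i)) -> \sum_i a i = 1 ->
  A (\sum_i a i *: x i).
Proof.
move=> cA; elim=> [|n IH] a x a0 Ax a1.
  by move: a1; rewrite big_ord0 => /esym/eqP; rewrite oner_eq0.
move: a1; rewrite !big_ord_recl; set s := \sum_(i < n) _ => a1.
have s0 : 0 <= s by exact: sumr_ge0.
(* The induction renormalizes the remaining weights by [s]; when [s = 0] they all vanish and only
   the first point is left. *)
have [sz|sn] := eqVneq s 0.
  have az i : a (lift ord0 i) = 0.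
    by move: sz => /psumr_eq0P -> // j _.
  rewrite big1 => [|i _]; last by rewrite az scale0r.
  by move: a1; rewrite sz !addr0 => ->; rewrite scale1r.
have t01 : 0 <= a ord0 <= 1 by rewrite a0 /= -a1 lerDl.
have -> : \sum_(i < n) a (lift ord0 i) *: x (lift ord0 i) =
    s *: \sum_(i < n) (a (lift ord0 i) / s) *: x (lift ord0 i).
  by rewrite scaler_sumr; apply: eq_bigr => i _; rewrite scalerA mulrC divfK.
have := cA (x ord0) (\sum_(i < n) (a (lift ord0 i) / s) *: x (lift ord0 i))
  (Itv01 (a0 ord0) (proj2 (andP t01))).
rewrite !inE => /(_ (Ax _)) H.
have {1}-> : s = 1 - a ord0 by rewrite -a1 addrC addKr.
apply: H; apply: IH => //.
  by move=> i; rewrite divr_ge0.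
by rewrite -mulr_suml divff.
Qed.

(** Row [i] is [v i] in homogeneous coordinates, so the left kernel consists of affine dependences,
    and the inverse, when it exists, sends the row [(1, x)] to the barycentric coordinates of
    [x]. *)
Definition bary_mx (R : realType) (d : nat) (v : 'I_d.+1 -> 'rV[R]_d) :
    'M[R]_(d.+1) :=
  row_mx (const_mx 1 : 'cV[R]_d.+1) (\matrix_i v i).

(* Junk unless [v] is affinely independent: [invmx] fixes singular matrices. *)
Definition bary (R : realType) (d : nat) (v : 'I_d.+1 -> 'rV[R]_d)
    (i : 'I_d.+1) (x : 'rV[R]_d) : R :=
  ((row_mx 1 x : 'rV[R]_d.+1) *m invmx (bary_mx v)) 0 i.

(** Gradient of the affine function [bary v i]: column [i] of the inverse without the entry of the
    constant coordinate. *)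
Definition bary_grad (R : realType) (d : nat) (v : 'I_d.+1 -> 'rV[R]_d)
    (i : 'I_d.+1) : 'rV[R]_d :=
  \row_k invmx (bary_mx v) (rshift 1 k) i.

Lemma baryD (R : realType) (d : nat) (v : 'I_d.+1 -> 'rV[R]_d) i x y :
  bary v i (x + y) = bary v i x + dot (bary_grad v i) y.
Proof.
have -> : dot (bary_grad v i) y =
    ((row_mx 0 y : 'rV[R]_(1 + d)) *m invmx (bary_mx v)) 0 i.
  rewrite mxE (@big_split_ord _ _ _ 1 d) /= big1 ?add0r; last first.
    by move=> k _; rewrite row_mxEl mxE mul0r.
  by apply: eq_bigr => k _; rewrite row_mxEr mxE mulrC.
rewrite /bary.
have -> : (row_mx 1 (x + y) : 'rV[R]_(1 + d)) = row_mx 1 x + row_mx 0 y.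
  by rewrite add_row_mx addr0.
by rewrite (mulmxDl (row_mx 1 x : 'rV[R]_(1 + d))) mxE.
Qed.

Lemma mul_bary_mx (R : realType) (d : nat) (v : 'I_d.+1 -> 'rV[R]_d)
    (u : 'rV[R]_d.+1) (c : R) (x : 'rV[R]_d) :
  u *m bary_mx v = (row_mx c%:M x : 'rV[R]_(1 + d)) ->
  \sum_i u 0 i = c /\ \sum_i u 0 i *: v i = x.
Proof.
have -> : u *m bary_mx v =
    (row_mx (u *m const_mx 1) (u *m \matrix_i v i) : 'rV[R]_(1 + d)).
  exact: (@mul_mx_row R 1 d.+1 1 d u (const_mx 1) (\matrix_i v i)).
move=> /(@eq_row_mx _ 1 1 d)[/matrixP/(_ 0 0) + <-].
rewrite !mxE mulr1n => <-; rewrite mulmx_sum_row.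
by split; apply: eq_bigr => i _; rewrite ?mxE ?mulr1 ?rowK.
Qed.

(** * Power of a point and the hulloid *)

Definition sphere_power (R : realType) (d : nat) (c : 'rV[R]_d) (rho : R)
    (x : 'rV[R]_d) : R :=
  dot (x - c) (x - c) - rho ^+ 2.

Lemma sphere_power_ge0 (R : realType) (d : nat) (c x : 'rV[R]_d) (rho : R) :
  0 <= rho -> 0 <= sphere_power c rho x <-> ~ eball c rho x.
Proof. by move=> r0; rewrite subr_ge0; split=> /eballP; apply. Qed.

Lemma hulloidP (R : realType) (d n : nat) (v : 'I_n -> 'rV[R]_d) (rho : R) x :
  0 <= rho -> hulloid rho (range v) x <->
  forall c, (forall i, 0 <= sphere_power c rho (v i)) -> 0 <= sphere_power c rho x.
Proof.
move=> r0; split=> [hx c hc|hx c /= hc].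
  apply/sphere_power_ge0 => //; apply: hx => /=.
  rewrite -subset0 => y [cy [i _ vy]]; move: cy; rewrite -vy.
  exact/sphere_power_ge0.
apply/sphere_power_ge0 => //; apply: hx => i.
apply/sphere_power_ge0 => // vi.
by have : (eball c rho `&` range v) (v i) by []; rewrite hc.
Qed.

Lemma closed_hulloid (R : realType) (d : nat) (rho : R) (E : set 'rV[R]_d) :
  0 <= rho -> closed (hulloid rho E).
Proof.
by move=> r0; apply: closed_bigI => c _; rewrite closedC; exact: open_eball.
Qed.

(** * Convexity and quadratic inequalities *)

Lemma jensen_dot (R : realType) (d n : nat) (t : 'I_n -> R) (w : 'I_n -> 'rV[R]_d) :
  (forall i, 0 <= t i) -> \sum_i t i <= 1 ->
  dot (\sum_i t i *: w i) (\sum_i t i *: w i) <= \sum_i t i * dot (w i) (w i).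
Proof.
move=> t0 t1; set W := \sum_i _.
(* The weighted variance about [W]; a total weight below one only strengthens the bound. *)
have : 0 <= \sum_i t i * dot (w i - W) (w i - W).
  by apply: sumr_ge0 => i _; rewrite mulr_ge0 ?dot_ge0.
have -> : \sum_i t i * dot (w i - W) (w i - W) =
    \sum_i (t i * dot (w i) (w i) - 2 * dot (t i *: w i) W + t i * dot W W).
  by apply: eq_bigr => i _; rewrite !dotE (dotC W); ring.
rewrite big_split sumrB /= -mulr_sumr -dot_suml -/W -mulr_suml.
have := dot_ge0 W; nra.
Qed.

Lemma quad_root_exists (R : realType) (A l s : R) : 0 < A -> 0 < s ->
  exists2 b, 0 < b & A * b ^+ 2 - l * b = s.
Proof.
move=> A0 s0; have As : 0 < A * s by exact: mulr_gt0.
have [D D0 D2] : exists2 D : R, 0 <= D & D ^+ 2 = l ^+ 2 + 4 * A * s.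
  exists (Num.sqrt (l ^+ 2 + 4 * A * s)); first exact: sqrtr_ge0.
  by rewrite sqr_sqrtr //; nra.
have lD : 0 < l + D.
  rewrite ltNge; apply/negP => lD.
  have : 0 <= (- l - D) * (D - l) by apply: mulr_ge0; lra.
  nra.
exists ((l + D) / (2 * A)); first by rewrite divr_gt0 // mulr_gt0.
have -> : A * ((l + D) / (2 * A)) ^+ 2 - l * ((l + D) / (2 * A)) =
    (D ^+ 2 - l ^+ 2) / (4 * A) by field; lra.
by rewrite D2; field; lra.
Qed.

(** The positive value at [b1] forces [A * b1 > l], and then any [b2] in [[0, b1)] has a strictly
    smaller value. This yields both monotonicity in the radius and uniqueness of the positive
    root. *)
Lemma quad_root_le (R : realType) (A l b1 b2 : R) : 0 <= A -> 0 < b1 -> 0 <= b2 ->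
  0 < A * b1 ^+ 2 - l * b1 ->
  A * b1 ^+ 2 - l * b1 <= A * b2 ^+ 2 - l * b2 -> b1 <= b2.
Proof.
move=> A0 b10 b20 s0 h; rewrite leNgt; apply/negP => lt.
have p : 0 < A * b1 - l by rewrite -(pmulr_rgt0 _ b10); lra.
have : 0 <= A * (b2 * (b1 - b2)) by rewrite !mulr_ge0 // subr_ge0 ltW.
have : b2 * (A * b1 - l) < b1 * (A * b1 - l) by rewrite ltr_pM2r.
lra.
Qed.

(** On [[0, M]] the quadratic is at most [A * M ^+ 2 + |l| * M], so a larger value lies at or beyond
    [M]. This makes the coefficients tend to infinity with the radius. *)
Lemma quad_root_ge (R : realType) (A l b M : R) : 0 <= A -> 0 < b ->
  A * M ^+ 2 + `|l| * M < A * b ^+ 2 - l * b -> M <= b.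
Proof.
move=> A0 b0 h; rewrite leNgt; apply/negP => lt.
have : - l * b <= `|l| * b by rewrite ler_pM2r // -normrN ler_norm.
have : `|l| * b <= `|l| * M by rewrite ler_wpM2l // ltW.
have : 0 <= A * ((M - b) * (M + b)) by rewrite !mulr_ge0 //; lra.
lra.
Qed.

(** * Simplex with affinely independent vertices *)

Section Barycentric.
Context (R : realType) (d : nat) (v : 'I_d.+1 -> 'rV[R]_d).
Hypothesis hv : affinely_independent v.

Lemma bary_mx_unit : bary_mx v \in unitmx.
Proof.
rewrite -row_free_unit; apply/inj_row_free => u.
move=> u0; apply/rowP => i; rewrite mxE.
have /mul_bary_mx[su sv] : u *m bary_mx v = (row_mx 0%:M 0 : 'rV[R]_(1 + d)).
  by rewrite u0 -scalemx1 scale0r (@row_mx0 _ _ 1 d).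
exact: (hv (a := fun i => u 0 i)).
Qed.

Lemma bary_sum_comb x :
  \sum_i bary v i x = 1 /\ \sum_i bary v i x *: v i = x.
Proof.
by apply: mul_bary_mx; rewrite mulmxKV // bary_mx_unit.
Qed.

Lemma sum_bary x : \sum_i bary v i x = 1.
Proof. by have [] := bary_sum_comb x. Qed.

Lemma bary_comb x : \sum_i bary v i x *: v i = x.
Proof. by have [] := bary_sum_comb x. Qed.

Lemma baryE (a : 'I_d.+1 -> R) :
  \sum_i a i = 1 -> forall i, bary v i (\sum_i a i *: v i) = a i.
Proof.
move=> a1 i; set x := \sum_i _; apply/eqP; rewrite -subr_eq0; apply/eqP.
apply: (hv (a := fun i => bary v i x - a i)).
  by rewrite sumrB sum_bary a1 subrr.
under eq_bigr do rewrite scalerBl.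
by rewrite sumrB bary_comb subrr.
Qed.

Lemma bary_vertex i j : bary v i (v j) = (i == j)%:R.
Proof.
have {1}-> : v j = \sum_i (i == j)%:R *: v i.
  rewrite (bigD1 j) //= eqxx scale1r big1 ?addr0 // => k /negbTE ->.
  by rewrite scale0r.
apply: baryE; rewrite (bigD1 j) //= eqxx big1 ?addr0 // => k /negbTE ->.
by [].
Qed.

Lemma convex_hull_bary :
  convex_hull (range v) = [set x | forall i, 0 <= bary v i x].
Proof.
apply/seteqP; split.
  apply: smallest_sub => [x y t /set_mem hx /set_mem hy|_ [j _ <-] i]; last first.
    by rewrite bary_vertex ler0n.
  apply/mem_set => i.
  have -> : conv t x y = t%:num *: (x : 'rV[R]_d) + (1 - t%:num) *: (y : 'rV[R]_d) by [].
  rewrite -(bary_comb x) -(bary_comb y) !scaler_sumr -big_split /=.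
  under eq_bigr do rewrite !scalerA -scalerDl.
  rewrite (baryE (a := fun i => t%:num * bary v i x + (1 - t%:num) * bary v i y)).
    by rewrite addr_ge0 // mulr_ge0 ?subr_ge0 ?le1.
  by rewrite big_split -!mulr_sumr !sum_bary /= !mulr1 addrC subrK.
move=> x hx A [cA vA].
rewrite -(bary_comb x).
apply: convex_set_comb => //; last exact: sum_bary.
by move=> i; apply: vA; exists i.
Qed.

(** Leibniz (parallel axis) identity: [x] is the centroid of the vertices for the weights
    [bary v i x], so the cross terms cancel. *)
Lemma dot_sum_bary x c :
  dot (x - c) (x - c) = \sum_i bary v i x * dot (v i - c) (v i - c)
                        - \sum_i bary v i x * dot (x - v i) (x - v i).
Proof.
have h : \sum_i bary v i x *: (v i - x) = 0.
  under eq_bigr do rewrite scalerBr.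
  by rewrite sumrB -scaler_suml sum_bary scale1r bary_comb subrr.
rewrite -sumrB.
have -> : \sum_i (bary v i x * dot (v i - c) (v i - c)
    - bary v i x * dot (x - v i) (x - v i)) =
  \sum_i (2 * dot (bary v i x *: (v i - x)) (x - c)
          + bary v i x * dot (x - c) (x - c)).
  apply: eq_bigr => i _; rewrite !dotE (dotC (v i) x) (dotC (v i) c) (dotC c x).
  ring.
by rewrite big_split /= -mulr_sumr -dot_suml h dot0l mulr0 add0r -mulr_suml sum_bary mul1r.
Qed.

Lemma circumradiusP : let r := circumradius (range v) in
  0 <= r /\ exists o, forall i, dot (v i - o) (v i - o) = r ^+ 2.
Proof.
rewrite /=; set P := [set r | 0 <= r /\ exists c, range v `<=` esphere c r].
suff /(xgetPex 0) : exists r, P r.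
  move=> [r0 [c hc]]; split=> //; exists c => i; apply/enorm_eq => //; by apply: hc; exists i.
(* The affine function [\sum_i |v i|^2 * bary v i x] interpolates [|x|^2] at the vertices and has
   gradient [z]; completing the square gives a sphere with center [z / 2] and squared radius [s]. *)
pose z : 'rV[R]_d := \sum_i dot (v i) (v i) *: bary_grad v i.
pose o : 'rV[R]_d := 2^-1 *: z.
pose s := \sum_i dot (v i) (v i) * bary v i 0 + dot z z / 4.
have e j : dot (v j - o) (v j - o) = s.
  have : \sum_i dot (v i) (v i) * bary v i (v j) = dot (v j) (v j).
    rewrite (bigD1 j) //= bary_vertex eqxx mulr1 big1 ?addr0 // => k /negbTE kj.
    by rewrite bary_vertex kj mulr0.
  under eq_bigr do rewrite -(add0r (v j)) baryD mulrDr -dotZl.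
  rewrite big_split -dot_suml -/z /= => h.
  by rewrite /s /o !dotE -h (dotC (v j) z); field.
exists (Num.sqrt s); split; first exact: sqrtr_ge0.
exists o => _ [i _ <-]; apply/enorm_eq; first exact: sqrtr_ge0.
by rewrite e sqr_sqrtr // -(e 0) dot_ge0.
Qed.

Lemma bary_grad_neq0 i : (0 < d)%N -> bary_grad v i != 0.
Proof.
move=> d0; apply/eqP => g0.
have [j ij] : exists j : 'I_d.+1, j != i.
  have [->|i0] := eqVneq i ord0; last by exists ord0; rewrite eq_sym.
  by exists ord_max; rewrite -val_eqE /= -lt0n.
have := baryD v i (v j) (v i - v j); rewrite addrC subrK g0 dot0l addr0.
by rewrite !bary_vertex eqxx eq_sym (negbTE ij) => /eqP; rewrite oner_eq0.
Qed.

Lemma vertex_inj : injective v.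
Proof.
move=> i j vij; apply/eqP; have := bary_vertex i j; rewrite -vij bary_vertex eqxx.
by case: eqP => // _ /eqP; rewrite oner_eq0.
Qed.

(** * Powers relative to the circumsphere *)

Context (o : 'rV[R]_d) (r : R).
Hypothesis ho : forall i, dot (v i - o) (v i - o) = r ^+ 2.

Local Notation pow c rho x := (sphere_power c rho x).
Local Notation lam := (bary v).
Local Notation grad := (bary_grad v).

Lemma power_circumsphere x :
  pow o r x = - \sum_i lam i x * dot (x - v i) (x - v i).
Proof.
rewrite /sphere_power dot_sum_bary.
under eq_bigr do rewrite ho.
by rewrite -mulr_suml sum_bary mul1r addrAC subrr add0r.
Qed.

Lemma power_bary c rho x :
  pow c rho x = pow o r x + \sum_i lam i x * pow c rho (v i).
Proof.
rewrite power_circumsphere {1}/sphere_power dot_sum_bary addrC.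
rewrite [in RHS]addrC /sphere_power.
under [in RHS]eq_bigr do rewrite mulrBr.
by rewrite sumrB -mulr_suml sum_bary mul1r addrCA [in RHS]addrAC addrA addrAC.
Qed.

(** Comparing the linear parts of the two sides of [power_bary]: the powers at the vertices
    determine the center. *)
Lemma center_grad c rho :
  c = o - 2^-1 *: \sum_i pow c rho (v i) *: grad i.
Proof.
apply: dot_inj => z.
have := power_bary c rho o; have := power_bary c rho (o + z).
under eq_bigr do rewrite baryD mulrDl mulrC [X in _ + X]mulrC -dotZl.
rewrite big_split -dot_suml /=; under eq_bigr do rewrite mulrC.
set S := \sum_(i < _) _ *: _; set s := \sum_(i < _) _.
rewrite /sphere_power !dotE (dotC z o) (dotC z c) (dotC c o).
lra.
Qed.

(** This is [power_bary] at [o]. With [center_grad] it places the vertex powers of all balls of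
    radius [rho] on one level set of a convex quadratic. *)
Lemma center_power c rho :
  dot (c - o) (c - o) - \sum_i lam i o * pow c rho (v i) = rho ^+ 2 - r ^+ 2.
Proof.
have := power_bary c rho o.
rewrite {1 2}/sphere_power -(opprB c o) !dotNl !dotNr opprK subrr dot0l; lra.
Qed.

(** Both sides have the same quadratic and linear parts; the equation for [b] equates their constant
    terms. *)
Lemma power_opposite i b rho x :
  dot (grad i) (grad i) / 4 * b ^+ 2 - lam i o * b = rho ^+ 2 - r ^+ 2 ->
  pow (o - (b / 2) *: grad i) rho x = pow o r x + b * lam i x.
Proof.
move=> hb; have -> : lam i x = lam i o + dot (grad i) (x - o).
  by rewrite -baryD addrC subrK.
rewrite /sphere_power !dotE (dotC o x) (dotC (grad i) x) (dotC (grad i) o).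
move: hb; lra.
Qed.

(** * Opposite balls: existence, uniqueness, dependence on the radius *)

Lemma is_opposite_ballP i rho B : 0 < rho ->
  is_opposite_ball (range v) (v i) rho B <->
  exists c, [/\ B = eball c rho, forall j, j != i -> pow c rho (v j) = 0
              & 0 <= pow c rho (v i)].
Proof.
move=> rho0; split=> [[[c ->] hb hi]|[c [-> hj hi]]].
  exists c; split=> // [j ji|]; last exact/sphere_power_ge0/hi/ltW.
  have : (range v `\ v i) (v j).
    by split=> [|/= /vertex_inj ij]; [exists j|rewrite ij eqxx in ji].
  by move=> /hb; rewrite boundary_eball // => /(enorm_eq _ (ltW rho0)) e;
    rewrite /sphere_power e subrr.
split; [by exists c | | exact/sphere_power_ge0/hi/ltW].
rewrite boundary_eball // => _ [[j _ <-] /= ij]; apply/enorm_eq; first exact: ltW.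
apply/eqP; rewrite -subr_eq0; apply/eqP/hj.
by apply/eqP => ji; apply: ij; rewrite ji.
Qed.

Hypothesis d_gt0 : (0 < d)%N.
Hypothesis r_ge0 : 0 <= r.

(* The opposite ball at [v i] has center [o - (b / 2) *: grad i] and power [b] at
   [v i]; see [opposite_ballE]. *)
Definition opposite_coef i rho b :=
  0 < b /\ dot (grad i) (grad i) / 4 * b ^+ 2 - lam i o * b = rho ^+ 2 - r ^+ 2.

Lemma sqr_radius_gt0 rho : r < rho -> 0 < rho ^+ 2 - r ^+ 2.
Proof. by move=> rr; have := r_ge0; rewrite subr_sqr => r0; apply: mulr_gt0; lra. Qed.

Lemma opposite_coef_exists i rho : r < rho -> exists b, opposite_coef i rho b.
Proof.
move=> rr; have [|b b0 hb] := @quad_root_exists R (dot (grad i) (grad i) / 4)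
  (lam i o) _ _ (sqr_radius_gt0 rr); last by exists b.
by rewrite divr_gt0 // dot_gt0 // bary_grad_neq0.
Qed.

Lemma opposite_coef_le i rho1 rho2 b1 b2 : r < rho1 -> rho1 <= rho2 ->
  opposite_coef i rho1 b1 -> opposite_coef i rho2 b2 -> b1 <= b2.
Proof.
move=> r1 r12 [b10 e1] [b20 e2].
apply: (@quad_root_le R (dot (grad i) (grad i) / 4) (lam i o)) => //.
- by rewrite divr_ge0 // dot_ge0.
- exact: ltW.
- by rewrite e1 sqr_radius_gt0.
- by rewrite e1 e2 lerD2r ler_pXn2r // nnegrE; have := r_ge0; lra.
Qed.

(** Only the power at [v i] can be nonzero, so [center_grad] and [center_power] leave a single
    unknown, which is the unique positive root of the quadratic. *)
Lemma opposite_ballE i rho b B : r < rho -> opposite_coef i rho b ->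
  is_opposite_ball (range v) (v i) rho B <->
  B = eball (o - (b / 2) *: grad i) rho.
Proof.
move=> rr cb; have [b0 hb] := cb.
have p0 j : pow o r (v j) = 0 by rewrite /sphere_power ho subrr.
have rho0 : 0 < rho by exact: le_lt_trans rr.
split=> [/(is_opposite_ballP _ _ rho0)[c [-> hj hi]]|->]; last first.
  apply/is_opposite_ballP => //; exists (o - (b / 2) *: grad i); split=> // [j ji|].
    by rewrite (power_opposite _ hb) p0 add0r bary_vertex eq_sym (negbTE ji) mulr0.
  by rewrite (power_opposite _ hb) p0 add0r bary_vertex eqxx mulr1 ltW.
have cE := center_grad c rho; have ce := center_power c rho.
have sg (F : 'I_d.+1 -> 'rV[R]_d) :
    \sum_j pow c rho (v j) *: F j = pow c rho (v i) *: F i.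
  by rewrite (bigD1 i) //= big1 ?addr0 // => j /hj ->; rewrite scale0r.
have sl : \sum_j lam j o * pow c rho (v j) = lam i o * pow c rho (v i).
  by rewrite (bigD1 i) //= big1 ?addr0 // => j /hj ->; rewrite mulr0.
rewrite sg in cE; rewrite sl in ce.
set be := pow c rho (v i) in cE ce hi.
have s0 := sqr_radius_gt0 rr.
have e : dot (grad i) (grad i) / 4 * be ^+ 2 - lam i o * be = rho ^+ 2 - r ^+ 2.
  have cw : c - o = - 2^-1 *: (be *: grad i).
    by rewrite {1}cE addrAC subrr add0r scaleNr.
  by rewrite -ce cw !dotE; field.
have be0 : 0 < be.
  rewrite lt_neqAle hi andbT; apply/eqP => z.
  by move: s0; rewrite -e -z expr0n /= !mulr0 subrr ltxx.
have bb : be = b.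
  (* Monotonicity in the radius, used both ways with equal radii, identifies the two roots. *)
  by apply/eqP; rewrite eq_le; apply/andP; split;
    apply: (@opposite_coef_le i rho rho).
by rewrite cE bb scalerA mulrC.
Qed.

(** * The hulloid in terms of powers *)

Lemma far_ball rho x : 0 < rho -> 0 < pow o r x ->
  exists2 c, forall i, 0 <= pow c rho (v i) & pow c rho x < 0.
Proof.
move=> rho0; rewrite /sphere_power subr_gt0 => h; have r0 := r_ge0.
have [D D0 D2] : exists2 D : R, 0 <= D & D ^+ 2 = dot (x - o) (x - o).
  by exists (Num.sqrt (dot (x - o) (x - o))); rewrite ?sqrtr_ge0 // sqr_sqrtr // dot_ge0.
have rD : r < D by rewrite -(@ltr_pXn2r _ 2) ?nnegrE // D2.
(* The center is taken on the ray from [o] through [x] at distance [k * D >= r + rho] from [o], so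
   the ball misses the circumball; the last condition puts [x] in it. *)
have key k : 0 <= k -> r + rho <= k * D -> (1 - k) ^+ 2 * D ^+ 2 < rho ^+ 2 ->
    exists2 c, forall i, 0 <= pow c rho (v i) & pow c rho x < 0.
  move=> k0 kD kr; exists (o + k *: (x - o)) => [i|]; rewrite /sphere_power.
    have -> : v i - (o + k *: (x - o)) = (v i - o) - k *: (x - o).
      by rewrite opprD addrA.
    have cs : dot (v i - o) (x - o) <= r * D.
      apply: le_trans (ler_norm _) _.
      rewrite -(@ler_pXn2r _ 2) ?nnegrE ?mulr_ge0 // real_normK ?num_real //.
      by rewrite exprMn D2 -(ho i) cauchy_schwarz.
    move: (ho i) cs (D2); move: (v i - o) (x - o) => m u mm cs uu.
    rewrite !dotE (dotC u m) -uu mm.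
    have : k * dot m u <= k * (r * D) by rewrite ler_wpM2l.
    have : 0 <= (k * D - r - rho) * (k * D - r + rho) by rewrite mulr_ge0 //; lra.
    lra.
  have -> : x - (o + k *: (x - o)) = (1 - k) *: (x - o).
    by rewrite opprD addrA scalerBl scale1r.
  by rewrite dotZl dotZr -D2 mulrA -expr2 subr_lt0.
(* A distant [x] can itself be the center. Otherwise the ball is externally tangent to the
   circumball, with center at distance [r + rho - D < rho] from [x]. *)
have [le|lt] := leP (r + rho) D.
  by apply: (key 1); rewrite ?mul1r // subrr expr0n mul0r exprn_gt0.
have Dn : D != 0 by lra.
apply: (key ((r + rho) / D)).
- by rewrite divr_ge0 //; lra.
- by rewrite divfK.
- have -> : (1 - (r + rho) / D) ^+ 2 * D ^+ 2 = (r + rho - D) ^+ 2 by field.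
  by rewrite ltr_pXn2r // ?nnegrE; lra.
Qed.

Lemma sum_power_coef_ge1 rho (b : 'I_d.+1 -> R) c : r < rho ->
  (forall i, opposite_coef i rho (b i)) ->
  (forall i, 0 <= pow c rho (v i)) -> 1 <= \sum_i pow c rho (v i) / b i.
Proof.
move=> rr hb hc; rewrite leNgt; apply/negP => lt.
(* Convexity: [c - o] would be a subconvex combination, of total weight less than
   [1], of the displacements [w i] of the opposite centers. *)
pose t i := pow c rho (v i) / b i; pose w i := - (b i / 2) *: grad i.
have b0 i : 0 < b i by have [] := hb i.
have te i : t i * b i = pow c rho (v i) by rewrite divfK // gt_eqF.
have t0 i : 0 <= t i by rewrite divr_ge0 // ltW.
have wE : c - o = \sum_i t i *: w i.
  rewrite {1}(center_grad c rho) addrAC subrr add0r scaler_sumr -sumrN.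
  apply: eq_bigr => i _; rewrite -te /w !scalerA -scaleNr; congr (_ *: _); ring.
have := jensen_dot w t0 (ltW lt); rewrite -wE.
have -> : \sum_i t i * dot (w i) (w i) =
    (\sum_i t i) * (rho ^+ 2 - r ^+ 2) + \sum_i lam i o * pow c rho (v i).
  rewrite mulr_suml -big_split; apply: eq_bigr => i _ /=.
  by have [_ <-] := hb i; rewrite -te /w !dotE; field.
(* [center_power] has [rho ^+ 2 - r ^+ 2] with weight one where the Jensen bound has it with weight
   [\sum_i t i < 1]: a contradiction. *)
have := center_power c rho; have := sqr_radius_gt0 rr.
rewrite -/(t _) in lt *; nra.
Qed.

Lemma hulloid_bary rho (b : 'I_d.+1 -> R) x : r < rho ->
  (forall i, opposite_coef i rho (b i)) ->
  hulloid rho (range v) x <->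
  pow o r x <= 0 /\ forall i, 0 <= pow o r x + b i * lam i x.
Proof.
move=> rr hb; have rho0 : 0 < rho by exact: le_lt_trans rr.
have b0 i : 0 < b i by have [] := hb i.
have p0 j : pow o r (v j) = 0 by rewrite /sphere_power ho subrr.
rewrite hulloidP; last exact: ltW.
split=> [hx|[px hx] c hc].
  split=> [|i].
    rewrite leNgt; apply/negP => /(far_ball rho0)[c hc].
    by rewrite ltNge hx.
  have [_ hi] := hb i; rewrite -(power_opposite _ hi); apply: hx => j.
  by rewrite (power_opposite _ hi) p0 add0r bary_vertex mulr_ge0 // ltW.
have s1 := sum_power_coef_ge1 rr hb hc.
rewrite (power_bary c rho) -subr_ge0 subr0.
(* The inequalities [hx] are summed with the weights [pow c rho (v i) / b i], whose total is at
   least one by [s1]; as [- pow o r x] is non-negative, this suffices. *)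
have : - pow o r x * \sum_i pow c rho (v i) / b i <= \sum_i lam i x * pow c rho (v i).
  rewrite mulr_sumr; apply: ler_sum => i _.
  have t0 : 0 <= pow c rho (v i) / b i by rewrite divr_ge0 // ltW.
  have {2}<- : pow c rho (v i) / b i * b i = pow c rho (v i) by rewrite divfK // gt_eqF.
  have := mulr_ge0 t0 (hx i); lra.
nra.
Qed.
End Barycentric.

(** * Contact of the simplex with its circumsphere, and its interior *)

Lemma sphere_simplex_vertex (R : realType) (d : nat) (v : 'I_d.+1 -> 'rV[R]_d)
    (o : 'rV[R]_d) (r : R) (x : 'rV[R]_d) : affinely_independent v ->
  (forall i, dot (v i - o) (v i - o) = r ^+ 2) ->
  (forall i, 0 <= bary v i x) -> 0 <= sphere_power o r x -> range v x.
Proof.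
move=> hv ho x0; rewrite (power_circumsphere hv ho) oppr_ge0 => s0.
have t0 i : 0 <= bary v i x * dot (x - v i) (x - v i) by rewrite mulr_ge0 ?dot_ge0.
(* Non-negative terms with sum at most zero all vanish, so a nonzero coordinate pins [x] to its
   vertex. *)
have /psumr_eq0P s00 : \sum_i bary v i x * dot (x - v i) (x - v i) = 0.
  by apply/eqP; rewrite eq_le s0 sumr_ge0.
have [i xi] : exists i, bary v i x != 0.
  apply/not_existsP => h; have := sum_bary hv x.
  rewrite big1 => [|i _]; last by apply/eqP; apply: contra_notT (h i).
  by move=> /esym/eqP; rewrite oner_eq0.
exists i => //; apply/eqP; rewrite eq_sym -subr_eq0; apply/eqP/dot_eq0.
have /eqP := s00 (fun i _ => t0 i) i isT.
by rewrite mulf_eq0 (negbTE xi) => /eqP.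
Qed.

Lemma interior_convex_hull_bary (R : realType) (d : nat)
    (v : 'I_d.+1 -> 'rV[R]_d) : (0 < d)%N -> affinely_independent v ->
  interior (convex_hull (range v)) = [set x | forall i, 0 < bary v i x].
Proof.
move=> d0 hv; rewrite convex_hull_bary //; apply/seteqP; split=> x.
  move=> xT i; have [e e0 he] := nbhs_segment (bary_grad v i) xT.
  (* A small step against the gradient strictly lowers coordinate [i], yet stays in the simplex. *)
  have /he/(_ i) : `|- (e / 2)| < e by rewrite normrN gtr0_norm; lra.
  have := dot_gt0 (bary_grad_neq0 hv i d0).
  rewrite baryD dotZr; nra.
move=> x0.
have cb i : continuous (bary v i).
  move=> y; have -> : bary v i = (fun z => bary v i 0 + dot (bary_grad v i) z).
    by apply/funext => z; rewrite -baryD add0r.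
  apply: (@cvgD _ _ _ (nbhs y) _ (cst (bary v i 0))); first exact: cvg_cst.
  apply: (@continuous_dot _ _ (cst (bary_grad v i)) id).
    exact: cst_continuous.
  by move=> z.
have op i : nbhs x [set y | 0 < bary v i y].
  apply: open_nbhs_nbhs; split; last exact: x0.
  by apply: (@open_comp _ _ (bary v i) [set y | 0 < y]) => [y _|];
    [exact: cb|exact: open_gt].
apply: filterS (@filter_forall _ _ _ (nbhs x) (nbhs_filter x) op) => y hy i.
exact: ltW (hy i).
Qed.

(** * Hulloid formula, closedness, monotonicity and limit *)

Theorem theorem3p5 (R : realType) (d : nat) (hd : (2 <= d)%N)
    (v : 'I_d.+1 -> 'rV[R]_d) (hv : affinely_independent v) :
  let V := range v in
  let T := convex_hull V in
  let r := circumradius V in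
  [/\ (forall rho : R, r < rho ->
        (forall i : 'I_d.+1,
           exists! B : set 'rV[R]_d, is_opposite_ball V (v i) rho B) /\
        (forall B : 'I_d.+1 -> set 'rV[R]_d,
           (forall i : 'I_d.+1, is_opposite_ball V (v i) rho (B i)) ->
           hulloid rho V = T `\` \bigcup_(i : 'I_d.+1) B i)),
      (forall rho : R, r < rho -> closed (hulloid rho V)),
      (forall rho1 rho2 : R, r < rho1 -> rho1 <= rho2 ->
         hulloid rho1 V `<=` hulloid rho2 V)
    & \bigcup_(rho in [set rho : R | r < rho]) hulloid rho V =
        V `|` interior T].
Proof.
move=> V T r; have [r0 [c ho]] := circumradiusP hv; rewrite -/V -/r in r0 ho.
have d0 : (0 < d)%N by exact: ltn_trans hd.
have coef rho : r < rho ->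
    exists b : 'I_d.+1 -> R, forall i, opposite_coef v c r i rho (b i).
  move=> rr; have /choice[b hb] i : exists b, opposite_coef v c r i rho b.
    exact: opposite_coef_exists.
  by exists b.
have TE : T = [set x | forall i, 0 <= bary v i x] by exact: convex_hull_bary.
have bary_ge0 rho b x : (forall i, opposite_coef v c r i rho (b i)) ->
    sphere_power c r x <= 0 ->
    (forall i, 0 <= sphere_power c r x + b i * bary v i x) ->
    forall i, 0 <= bary v i x.
  move=> hb px hx i; have [b0 _] := hb i.
  by rewrite -(pmulr_rge0 _ b0); have := hx i; lra.
have mono rho1 rho2 : r < rho1 -> rho1 <= rho2 -> hulloid rho1 V `<=` hulloid rho2 V.
  move=> r1 r12 x; have r2 := lt_le_trans r1 r12.
  have [b1 hb1] := coef _ r1; have [b2 hb2] := coef _ r2.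
  move=> /(hulloid_bary hv ho r0 x r1 hb1)[px hx].
  apply/(hulloid_bary hv ho r0 x r2 hb2); split=> // i.
  have b12 : b1 i <= b2 i by exact: opposite_coef_le (hb1 i) (hb2 i).
  (* Since the coordinates are non-negative on the smaller hulloid, enlarging the coefficients
     preserves the inequalities. *)
  apply: le_trans (hx i) _; rewrite lerD2l ler_wpM2r //.
  exact: bary_ge0 hb1 px hx i.
split=> // [rho rr|rho rr|].
- have rho0 : 0 < rho by exact: le_lt_trans rr.
  have [b hb] := coef _ rr.
  have E i B := opposite_ballE hv ho r0 B rr (hb i).
  split=> [i|B /(_ _)/E hB].
    exists (eball (c - (b i / 2) *: bary_grad v i) rho); split; first exact/E.
    by move=> B /E ->.
  have ballE i x : B i x <-> sphere_power c r x + b i * bary v i x < 0.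
    have [_ hi] := hb i; rewrite hB -(power_opposite _ hi) ltNge; split.
      by move=> Bx; apply/negP => /(sphere_power_ge0 _ _ (ltW rho0)).
    by apply: contraNP => /(sphere_power_ge0 _ _ (ltW rho0)).
  rewrite TE; apply/seteqP; split=> x.
    move=> /(hulloid_bary hv ho r0 x rr hb)[px hx]; split.
      exact: bary_ge0 hb px hx.
    by move=> [i _ /ballE]; rewrite ltNge hx.
  move=> [/= x0 hx]; apply/(hulloid_bary hv ho r0 x rr hb); split.
    rewrite (power_circumsphere hv ho) oppr_le0 sumr_ge0 // => i _.
    by rewrite mulr_ge0 ?dot_ge0.
  move=> i; rewrite leNgt; apply/negP => /ballE Bx.
  by apply: hx; exists i.
- by apply: closed_hulloid; apply: ltW; exact: le_lt_trans rr.
rewrite interior_convex_hull_bary //; apply/seteqP; split=> x.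
  move=> [rho /= rr]; have [b hb] := coef _ rr.
  move=> /(hulloid_bary hv ho r0 x rr hb)[px hx].
  have x0 := bary_ge0 _ _ _ hb px hx.
  (* A vanishing coordinate turns its inequality into non-negative power with respect to the
     circumsphere, which within the simplex happens only at vertices. *)
  have [xp|/existsNP[i xi]] := pselect (forall i, 0 < bary v i x); first by right.
  left; apply: (sphere_simplex_vertex hv ho x0).
  have xi0 : bary v i x = 0.
    by apply/eqP; rewrite eq_le x0 andbT leNgt; apply/negP.
  by have := hx i; rewrite xi0 mulr0 addr0.
move=> [[j _ <-]|x0].
  have rr : r < r + 1 by rewrite ltrDl.
  exists (r + 1) => //; have [b hb] := coef _ rr.
  apply/(hulloid_bary hv ho r0 _ rr hb).
  rewrite /sphere_power ho subrr; split=> // i; have [b0 _] := hb i.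
  by rewrite add0r bary_vertex // mulr_ge0 // ltW.
pose p := - sphere_power c r x.
(* The inequality for [i] amounts to [M i <= b i], which [quad_root_ge] grants once
   [rho ^+ 2 - r ^+ 2 > K i]. Summing the [K i] gives one radius for all [i], as
   [(r + 1 + S) ^+ 2 - r ^+ 2 > S]. *)
pose M i := p / bary v i x.
pose K i := dot (bary_grad v i) (bary_grad v i) / 4 * M i ^+ 2 + `|bary v i c| * M i.
have p0 : 0 <= p.
  rewrite /p (power_circumsphere hv ho) opprK sumr_ge0 // => i _.
  by rewrite mulr_ge0 ?dot_ge0 // ltW.
have K0 i : 0 <= K i.
  by rewrite addr_ge0 // mulr_ge0 ?divr_ge0 ?dot_ge0 ?sqr_ge0 // ltW.
have KS i : K i <= \sum_j K j by rewrite (bigD1 i) //= lerDl sumr_ge0.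
have S0 : 0 <= \sum_j K j by exact: sumr_ge0.
set S := \sum_j K j in KS S0.
have rr : r < r + 1 + S by lra.
exists (r + 1 + S) => //; have [b hb] := coef _ rr.
apply/(hulloid_bary hv ho r0 _ rr hb); split; first by rewrite -oppr_ge0.
move=> i; have [b0 hi] := hb i.
have : M i <= b i.
  apply: (@quad_root_ge R (dot (bary_grad v i) (bary_grad v i) / 4)
    (bary v i c)) => //; first by rewrite divr_ge0 // dot_ge0.
  rewrite hi; apply: le_lt_trans (KS i) _; nra.
by rewrite ler_pdivrMr ?x0 // /p; lra.
Qed.
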